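(* Let $a<b$ be real numbers and let $f:[a,b]\to\mathbb{R}$ (possibly multiextremal and non-differentiable) assume only finite values and satisfy $|f(x)-f(y)|\le L|x-y|$ for all $x,y\in[a,b]$, where $0<L<\infty$ is a finite constant. Let $\alpha>0$ and $\beta$ be numbers representable in the grossone-based numeral system, each of which may be finite, infinite or infinitesimal, and consider the problem of minimizing $g(x)=\alpha f(x)+\beta$ over $x\in[a,b]$. Then the algorithms belonging to the General Scheme (GS), i.e. those obtained by choosing one of the four Lipschitz-estimate rules (2.1), (2.2), (2.3), (2.4) together with one of the two characteristic rules (3.1), (3.2), applied for solving this problem, are strongly homogeneous for finite, infinite and infinitesimal $\alpha>0$ and $\beta$: each generates the same sequence of trial points when optimizing $g$ as when optimizing $f$. (Under rule (2.1), the a priori estimate used for $g$ is $\alpha$ times the one used for $f$; the parameters $r$ and $\varepsilon$ are the same for $f$ and $g$.)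
   Context: **Numbers.** In the Infinity Computing framework, finite, infinite and infinitesimal numbers are represented in a positional numeral system with infinite base $G$ (called grossone), introduced as the number of elements of the set of natural numbers. A number is written as $C=c_{p_m}G^{p_m}+\dots+c_{p_1}G^{p_1}+c_{p_0}G^{p_0}+c_{p_{-1}}G^{p_{-1}}+\dots+c_{p_{-k}}G^{p_{-k}}$, where the written coefficients (grossdigits) are nonzero, positive or negative, finite numbers expressed in a traditional numeral system, and the exponents (grosspowers) satisfy $p_m>\dots>p_1>p_0>p_{-1}>\dots>p_{-k}$ with $p_0=0$; terms with zero coefficient are not written. Here $G^0=1$ and $G^{-1}\cdot G=G\cdot G^{-1}=1$. Finite numbers are represented using only the grosspower $0$; the simplest infinite numbers have at least one finite grosspower greater than zero; simple infinitesimals have only finite negative grosspowers (e.g. $G^{-1}$). The values of $g$ and all quantities computed from them below are handled in this framework. **General Scheme (GS)** applied to an objective function $\varphi$ on $[a,b]$ (here $\varphi=f$ or $\varphi=g$), with a given accuracy $\varepsilon>0$. Trial points are the points at which $\varphi$ is evaluated. *Step 0.* Execute the first two trials at $x^1=a$ and $x^2=b$, and set $k=2$. *Step 1.* Reorder the trial points $x^1,\dots,x^k$ as $a=x_1<\dots<x_k=b$ and put $z_i=\varphi(x_i)$, $1\le i\le k$. *Step 2.* For each subinterval $[x_{i-1},x_i]$, $2\le i\le k$, compute an estimate $l_i$ of the Lipschitz constant by one of the following rules, where $r>0$ is a reliability parameter, $H_i=\frac{|z_i-z_{i-1}|}{x_i-x_{i-1}}$, $H^k=\max\{H_i:2\le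 i\le k\}$, $\lambda_i=\max\{H_{i-1},H_i,H_{i+1}\}$ (for $i=2$ only $H_2,H_3$, and for $i=k$ only $H_{k-1},H_k$, are considered), $X^{\max}=\max\{x_i-x_{i-1}:2\le i\le k\}$, and $\gamma_i=H^k\frac{x_i-x_{i-1}}{X^{\max}}$: - (2.1) a priori given estimate: $l_i=\overline{L}$, where $\overline{L}$ is a given constant larger than the Lipschitz constant of the objective function; - (2.2) global estimate: $l_i=r H^k$ if $H^k>0$, and $l_i=1$ otherwise; - (2.3) ''Maximum'' local tuning: $l_i=r\max\{\lambda_i,\gamma_i\}$ if $H^k>0$, and $l_i=1$ otherwise; - (2.4) ''Maximum-Additive'' local tuning: $l_i=r\max\{H_i,\frac{\lambda_i+\gamma_i}{2}\}$ if $H^k>0$, and $l_i=1$ otherwise. *Step 3.* For each $2\le i\le k$ compute the characteristic $R_i$ by one of the following rules: - (3.1) geometric methods: $R_i=\frac{z_i+z_{i-1}}{2}-l_i\frac{x_i-x_{i-1}}{2}$; - (3.2) information methods: $R_i=2(z_i+z_{i-1})-l_i(x_i-x_{i-1})-\frac{(z_i-z_{i-1})^2}{l_i(x_i-x_{i-1})}$. *Step 4.* Let $t$ be the smallest index in $\{2,\dots,k\}$ at which $R_i$ attains its minimum over $2\le i\le k$. *Step 5.* If $x_t-x_{t-1}\le\varepsilon$, stop and take $\min_{1\le i\le k}z_i$, and a trial point where it is attained, as the estimate of the global minimum. Otherwise go to Step 6. *Step 6.* Execute the next trial at $x^{k+1}=\frac{x_t+x_{t-1}}{2}-\frac{z_t-z_{t-1}}{2l_t}$,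 replace $k$ by $k+1$, and go to Step 1. **Strong homogeneity.** An algorithm is called strongly homogeneous if it generates the same sequences of trials (evaluations of the objective function) when optimizing the original function $f$ and the scaled function $g=\alpha f+\beta$, where $\alpha>0$ and $\beta$ are constants. *)

(* Defs.v *)
From HB Require Import structures.
From mathcomp Require Import all_boot all_order all_algebra.
From mathcomp Require Import boolp reals ring.

Set Implicit Arguments.
Unset Strict Implicit.
Unset Printing Implicit Defensive.

Import Order.TTheory GRing.Theory Num.Theory.
Local Open Scope ring_scope.

(** * Numerals with base G

  A record c_m G^(p_m) + ... + c_(-k) G^(p_(-k)) is the sequence of the pairs
  (grosspower, grossdigit), listed by strictly decreasing grosspowers and
  without zero grossdigits; [R] is the type of grossdigits, [E] the type of
  grosspowers. *)

Section Numeral.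
Variables (R : realFieldType) (E : realDomainType).
Implicit Types (s : seq (E * R)) (p q : E).

Definition well_written s :=
  sorted (fun t u => u.1 < t.1) s && all (fun t => t.2 != 0) s.

Record numeral := Numeral { terms : seq (E * R); _ : well_written terms }.

HB.instance Definition _ := [isSub for terms].
HB.instance Definition _ := [Choice of numeral by <:].
Implicit Types x y z : numeral.

Definition eval_terms (F : E -> R) s : R := \sum_(t <- s) F t.1 * t.2.

Definition coef s p : R := eval_terms (fun q => (q == p)%:R) s.

(* Collects the terms that have the same grosspower and sorts them. *)
Definition collect s : seq (E * R) :=
  [seq t <- [seq (p, coef s p) | p <- sort >=%O (undup (map fst s))]
     | t.2 != 0].

Lemma collect_well_written s : well_written (collect s).
Proof.
rewrite /well_written filter_all andbT sorted_filter //.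
  by move=> ? ? ? /[swap]; apply: lt_trans.
rewrite sorted_map /=; set r := sort _ _.
have : sorted >=%O r by apply: sort_sorted; move=> x y; apply: le_total.
have : uniq r by rewrite sort_uniq undup_uniq.
elim: r => //= p [|q r] IHr //= /andP[pr ur] /andP[qp sr].
have /= -> := IHr ur sr; rewrite andbT lt_neqAle (qp : q <= p) andbT.
by move: pr; rewrite inE negb_or eq_sym => /andP[].
Qed.

Definition numeral_of s := Numeral (collect_well_written s).

Lemma eval_collect F s : eval_terms F (collect s) = eval_terms F s.
Proof.
rewrite /eval_terms big_filter big_map.
have -> : \sum_(p <- sort >=%O (undup (map fst s)) | coef s p != 0)
             F p * coef s p
        = \sum_(p <- undup (map fst s)) F p * coef s p.
  rewrite (perm_big (undup (map fst s))) ?perm_sort //= big_mkcond /=.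
  apply: eq_bigr => p _; case: eqP => //= ->; by rewrite mulr0.
rewrite (eq_bigr (fun p => \sum_(t <- s) F p * ((t.1 == p)%:R * t.2))); last first.
  by move=> p _; rewrite mulr_sumr.
rewrite exchange_big /= big_seq [RHS]big_seq; apply: eq_bigr => t ts.
rewrite (bigD1_seq t.1) ?undup_uniq //=; last first.
  by rewrite mem_undup; apply: map_f.
rewrite eqxx mul1r big1 ?addr0 // => p pt.
by rewrite eq_sym (negPf pt) mul0r mulr0.
Qed.

Lemma coef_collect s p : coef (collect s) p = coef s p.
Proof. exact: eval_collect. Qed.

Lemma coef_cat s1 s2 p : coef (s1 ++ s2) p = coef s1 p + coef s2 p.
Proof. by rewrite /coef /eval_terms big_cat. Qed.

Lemma coef_cons t s p : coef (t :: s) p = (t.1 == p)%:R * t.2 + coef s p.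
Proof. by rewrite /coef /eval_terms big_cons. Qed.

Lemma coef_nil p : coef [::] p = 0.
Proof. by rewrite /coef /eval_terms big_nil. Qed.

Lemma well_written_cons t s :
  well_written (t :: s) =
  [&& t.2 != 0, all (fun u => u.1 < t.1) s & well_written s].
Proof.
rewrite /well_written /= path_sortedE; last first.
  by move=> ? ? ? /[swap]; apply: lt_trans.
by case: (t.2 != 0); rewrite ?andbF //= -andbA.
Qed.

Lemma coef_above s p q : all (fun u => u.1 < p) s -> p <= q -> coef s q = 0.
Proof.
elim: s => [|t s IHs] /=; first by rewrite coef_nil.
move=> /andP[tp sp] pq; rewrite coef_cons IHs // addr0.
by rewrite lt_eqF ?mul0r // (lt_le_trans tp).
Qed.

Lemma mem_coef s t :
  well_written s -> (t \in s) = (t.2 != 0) && (coef s t.1 == t.2).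
Proof.
elim: s => [|u s IHs].
  by rewrite coef_nil eq_sym; case: (_ == _).
rewrite well_written_cons => /and3P[u0 us ws].
rewrite inE coef_cons; have [tu|tu] := eqVneq u.1 t.1.
  rewrite (coef_above us) -?tu // mul1r addr0.
  have -> : (t \in s) = false.
    by apply/negP => /(allP us); rewrite tu ltxx.
  rewrite orbF; apply/eqP/andP => [->|[_ /eqP ut]]; first by rewrite eqxx.
  by rewrite [t]surjective_pairing -tu -ut -surjective_pairing.
rewrite mul0r add0r IHs //; case: eqP => // ut.
by move: tu; rewrite ut eqxx.
Qed.

Lemma numeral_ext (x y : numeral) : coef (val x) =1 coef (val y) -> x = y.
Proof.
move=> xy; apply: val_inj; case: x y xy => [s ws] [u wu] /= xy.
apply: (@irr_sorted_eq _ (fun t u : E * R => u.1 < t.1)).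
- by move=> ? ? ? /[swap]; apply: lt_trans.
- by move=> ? /=; rewrite ltxx.
- by case/andP: ws.
- by case/andP: wu.
by move=> t; rewrite !mem_coef // xy.
Qed.

Definition num_zero : numeral := numeral_of [::].
Definition num_one : numeral := numeral_of [:: (0, 1)].
Definition num_add (x y : numeral) := numeral_of (val x ++ val y).
Definition num_opp (x : numeral) := numeral_of [seq (t.1, - t.2) | t <- val x].
Definition num_mul (x y : numeral) :=
  numeral_of [seq (t.1 + u.1, t.2 * u.2) | t <- val x, u <- val y].

Lemma coef_opp x p : coef (val (num_opp x)) p = - coef (val x) p.
Proof.
rewrite coef_collect /coef /eval_terms big_map /= -sumrN.
by apply: eq_bigr => t _; rewrite mulrN.
Qed.

Lemma coef_add x y p :
  coef (val (num_add x y)) p = coef (val x) p + coef (val y) p.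
Proof. by rewrite coef_collect coef_cat. Qed.

Lemma coef_zero p : coef (val num_zero) p = 0.
Proof. by rewrite coef_collect coef_nil. Qed.

Lemma eval_mul F x y :
  eval_terms F (val (num_mul x y)) =
  eval_terms (fun p => eval_terms (fun q => F (p + q)) (val y)) (val x).
Proof.
rewrite eval_collect /eval_terms big_allpairs_dep /=.
apply: eq_bigr => t _; rewrite mulr_suml; apply: eq_bigr => u _.
by rewrite mulrA -[RHS]mulrA [u.2 * _]mulrC mulrA.
Qed.

Lemma eval_add F x y :
  eval_terms F (val (num_add x y)) = eval_terms F (val x) + eval_terms F (val y).
Proof. by rewrite eval_collect /eval_terms big_cat. Qed.

Fact num_addA : associative num_add.
Proof. by move=> x y z; apply: numeral_ext => p; rewrite !coef_add addrA. Qed.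

Fact num_addC : commutative num_add.
Proof. by move=> x y; apply: numeral_ext => p; rewrite !coef_add addrC. Qed.

Fact num_add0 : left_id num_zero num_add.
Proof.
by move=> x; apply: numeral_ext => p; rewrite coef_add coef_zero add0r.
Qed.

Fact num_addN : left_inverse num_zero num_opp num_add.
Proof.
move=> x; apply: numeral_ext => p.
by rewrite coef_add coef_opp coef_zero addNr.
Qed.

HB.instance Definition _ :=
  GRing.isZmodule.Build numeral num_addA num_addC num_add0 num_addN.

Lemma eq_eval F F' s : F =1 F' -> eval_terms F s = eval_terms F' s.
Proof. by move=> FF'; apply: eq_bigr => t _; rewrite FF'. Qed.

Lemma eval_cons F t s : eval_terms F (t :: s) = F t.1 * t.2 + eval_terms F s.
Proof. by rewrite /eval_terms big_cons. Qed.

Lemma eval_seq1 F t : eval_terms F [:: t] = F t.1 * t.2.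
Proof. by rewrite /eval_terms big_seq1. Qed.

Lemma eval_eq0 F s : (forall t, t \in s -> F t.1 = 0) -> eval_terms F s = 0.
Proof.
by move=> F0; rewrite /eval_terms big_seq big1 // => t /F0 ->; rewrite mul0r.
Qed.

Fact num_mulA : associative num_mul.
Proof.
move=> x y z; apply: numeral_ext => p; rewrite /coef !eval_mul.
apply: eq_eval => q; rewrite eval_mul; apply: eq_eval => q'.
by apply: eq_eval => ?; rewrite addrA.
Qed.

Fact num_mulC : commutative num_mul.
Proof.
move=> x y; apply: numeral_ext => p; rewrite /coef !eval_mul /eval_terms.
under eq_bigr do rewrite mulr_suml.
rewrite exchange_big /=; apply: eq_bigr => t _.
by rewrite mulr_suml; apply: eq_bigr => u _; rewrite mulrAC addrC.
Qed.

Fact num_mul1 : left_id num_one num_mul.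
Proof.
move=> x; apply: numeral_ext => p; rewrite /coef eval_mul eval_collect.
rewrite {1}/eval_terms big_seq1 mulr1.
by apply: eq_eval => q; rewrite add0r.
Qed.

Fact num_mulDl : left_distributive num_mul num_add.
Proof.
move=> x y z; apply: numeral_ext => p.
by rewrite coef_add /coef !eval_mul eval_add.
Qed.

Fact num_one_neq0 : num_one != num_zero.
Proof.
apply/eqP => /(congr1 (fun x => coef (val x) 0)).
rewrite coef_zero coef_collect coef_cons coef_nil eqxx mulr1 addr0.
by move/eqP; rewrite oner_eq0.
Qed.

HB.instance Definition _ := GRing.Zmodule_isComNzRing.Build numeral
  num_mulA num_mulC num_mul1 num_mulDl num_one_neq0.

Definition lead (x : numeral) : R := (head (0, 0) (val x)).2.

Lemma lead0 : lead 0 = 0.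
Proof. by []. Qed.

Lemma lead_eq0 x : (lead x == 0) = (x == 0).
Proof.
apply/idP/eqP => [|->]; last by rewrite lead0.
case: x => [[|t s] ws] x0; first exact: val_inj.
by have := ws; rewrite well_written_cons (eqP x0 : t.2 = 0) eqxx.
Qed.

Lemma leadP x : x != 0 -> exists p,
  [/\ coef (val x) p = lead x, lead x != 0
    & forall q, p < q -> coef (val x) q = 0].
Proof.
rewrite -lead_eq0; case: x => [[|t s] ws]; first by rewrite eqxx.
move=> x0; have := ws; rewrite {1}well_written_cons => /and3P[_ ts _].
exists t.1; split=> //=.
  by rewrite coef_cons eqxx mul1r (coef_above ts) ?addr0.
move=> q tq; rewrite coef_cons (coef_above ts) ?ltW // addr0.
by rewrite lt_eqF ?mul0r.
Qed.

Lemma lead_at x p : coef (val x) p != 0 ->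
  (forall q, p < q -> coef (val x) q = 0) -> lead x = coef (val x) p.
Proof.
move=> xp0 xp; have x0 : x != 0.
  by apply: contraNneq xp0 => ->; rewrite coef_zero.
have [q [<- xq0 xq]] := leadP x0; congr coef.
case: (ltgtP q p) => // [qp|pq]; first by move: xp0; rewrite xq ?eqxx.
by move: xq0; rewrite xp ?eqxx.
Qed.

Lemma leadN x : lead (- x) = - lead x.
Proof.
have [->|x0] := eqVneq x 0; first by rewrite oppr0 lead0 oppr0.
have [p [xp xp0 xq]] := leadP x0.
rewrite -xp -coef_opp; apply: lead_at => [|q pq].
  by rewrite coef_opp oppr_eq0 xp.
by rewrite coef_opp xq ?oppr0.
Qed.

Lemma lead_add_gt0 x y : 0 < lead x -> 0 < lead y -> 0 < lead (x + y).
Proof.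
have lead_nz z : 0 < lead z -> z != 0 by rewrite -lead_eq0 => /lt0r_neq0.
wlog: x y / exists p q, [/\ coef (val x) p = lead x, coef (val y) q = lead y,
    forall r, p < r -> coef (val x) r = 0,
    forall r, q < r -> coef (val y) r = 0 & p <= q].
  move=> H x0 y0; have [p [xp _ px]] := leadP (lead_nz _ x0).
  have [q [yq _ qy]] := leadP (lead_nz _ y0).
  case: (leP p q) => [pq|/ltW qp]; first by apply: H => //; exists p, q.
  by rewrite addrC; apply: H => //; exists q, p.
move=> [p [q [xp yq px qy pq]]] x0 y0.
have xyq : 0 < coef (val (x + y)) q.
  rewrite coef_add yq; move: pq; rewrite le_eqVlt => /predU1P[<-|pq].
    by rewrite xp addr_gt0.
  by rewrite px ?add0r.
rewrite (@lead_at _ q) ?lt0r_neq0 // => r qr.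
by rewrite coef_add qy // px ?addr0 // (le_lt_trans pq).
Qed.

Lemma leadM x y : lead (x * y) = lead x * lead y.
Proof.
have [->|x0] := eqVneq x 0; first by rewrite mul0r lead0 mul0r.
have [->|y0] := eqVneq y 0; first by rewrite mulr0 lead0 mulr0.
case: x x0 => [[|[p c] s] ws]; rewrite -lead_eq0 /lead /= ?eqxx // => c0.
case: y y0 => [[|[q d] u] wu]; rewrite -lead_eq0 /lead /= ?eqxx // => d0.
set x := Numeral ws; set y := Numeral wu; change (lead (x * y) = c * d).
have below r : p + q <= r ->
    coef (val (x * y)) r = (p + q == r)%:R * (c * d).
  move=> pqr; rewrite /coef eval_mul.
  move: (ws) (wu); rewrite !well_written_cons /= => /and3P[_ ps _] /and3P[_ qu _].
  have out p' q' : p' <= p -> q' <= q -> (p' < p) || (q' < q) ->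
      (p' + q' == r) = false.
    move=> pp qq /orP[lt|lt]; rewrite lt_eqF // (lt_le_trans _ pqr) //.
      exact: ltr_leD.
    exact: ler_ltD.
  rewrite eval_cons [X in _ + X]eval_eq0 ?addr0 => [|[p' c'] p's] /=; last first.
    have pp := allP ps _ p's; apply: eval_eq0 => -[q' d'].
    rewrite inE => /predU1P[[-> _]|/(allP qu _) qq] /=.
      by rewrite out ?(ltW pp) // pp.
    by rewrite out ?(ltW pp) ?(ltW qq) // pp.
  rewrite eval_cons [X in _ + X]eval_eq0 ?addr0 => [|[q' d'] q'u] /=; last first.
    by have qq := allP qu _ q'u; rewrite out ?qq ?orbT // ltW.
  by rewrite -mulrA [d * c]mulrC.
rewrite (@lead_at _ (p + q)) ?below ?eqxx ?mul1r ?mulf_neq0 //.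
by move=> r pqr; rewrite below ?ltW // lt_eqF ?mul0r.
Qed.

Definition num_unit : {pred numeral} := fun x => `[< exists y, y * x == 1 >].

Definition num_inv (x : numeral) : numeral :=
  if pselect (exists y, y * x == 1) is left e then xchoose e else x.

Fact num_mulVx : {in num_unit, left_inverse 1 num_inv *%R}.
Proof.
move=> x /asboolP ux; rewrite /num_inv; case: pselect => // e.
exact/eqP/(xchooseP e).
Qed.

Fact num_unitPl x y : y * x = 1 -> num_unit x.
Proof. by move=> yx; apply/asboolP; exists y; apply/eqP. Qed.

Fact num_invr_out : {in [predC num_unit], num_inv =1 id}.
Proof.
by move=> x /asboolPn ux; rewrite /num_inv; case: pselect.
Qed.

HB.instance Definition _ := GRing.ComNzRing_hasMulInverse.Build numeral
  num_mulVx num_unitPl num_invr_out.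

Fact num_integral : GRing.integral_domain_axiom numeral.
Proof.
by move=> x y /eqP; rewrite -lead_eq0 leadM mulf_eq0 !lead_eq0.
Qed.

HB.instance Definition _ := GRing.ComUnitRing_isIntegral.Build numeral
  num_integral.

(* The sign of a numeral is that of its first grossdigit. *)
Definition num_lt (x y : numeral) : bool := 0 < lead (y - x).
Definition num_le (x y : numeral) : bool := (x == y) || num_lt x y.
Definition num_norm (x : numeral) : numeral := if num_lt x 0 then - x else x.

Fact num_lt0_add x y : num_lt 0 x -> num_lt 0 y -> num_lt 0 (x + y).
Proof. by rewrite /num_lt !subr0; apply: lead_add_gt0. Qed.

Fact num_lt0_mul x y : num_lt 0 x -> num_lt 0 y -> num_lt 0 (x * y).
Proof. by rewrite /num_lt !subr0 leadM; apply: mulr_gt0. Qed.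

Fact num_lt0_ngt0 x : num_lt 0 x -> ~~ num_lt x 0.
Proof. by rewrite /num_lt subr0 sub0r leadN oppr_gt0 -leNgt; apply: ltW. Qed.

Fact num_sub_gt0 x y : num_lt 0 (y - x) = num_lt x y.
Proof. by rewrite /num_lt subr0. Qed.

Fact num_lt0_total x : x != 0 -> num_lt 0 x || num_lt x 0.
Proof.
by rewrite /num_lt subr0 sub0r leadN oppr_gt0 orbC -lead_eq0 neq_lt.
Qed.

Fact num_normN x : num_norm (- x) = num_norm x.
Proof.
have [->|x0] := eqVneq x 0; first by rewrite oppr0.
rewrite /num_norm; have := num_lt0_total x0; have := @num_lt0_ngt0 x.
rewrite /num_lt !subr0 !sub0r opprK.
by case: (0 < lead x) => [/(_ isT)/negPf -> _|_ /= ->]; rewrite ?opprK.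
Qed.

Fact num_ge0_norm x : num_le 0 x -> num_norm x = x.
Proof.
move=> /predU1P[<-|x0]; first by rewrite /num_norm oppr0 if_same.
by rewrite /num_norm (negPf (num_lt0_ngt0 x0)).
Qed.

Fact num_le_def x y : num_le x y = (x == y) || num_lt x y.
Proof. by []. Qed.

HB.instance Definition _ := Num.IntegralDomain_isLtReal.Build numeral
  num_lt0_add num_lt0_mul num_lt0_ngt0 num_sub_gt0 num_lt0_total num_normN
  num_ge0_norm num_le_def.

(** [fin_num c] is c G^0 and [Gpow p] is G^p. *)

Definition fin_num (c : R) : numeral := numeral_of [:: (0, c)].
Definition Gpow (p : E) : numeral := numeral_of [:: (p, 1)].

Lemma coef_fin_num c p : coef (val (fin_num c)) p = (0 == p)%:R * c.
Proof. by rewrite coef_collect coef_cons coef_nil addr0. Qed.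

Lemma coef_Gpow p q : coef (val (Gpow p)) q = (p == q)%:R.
Proof. by rewrite coef_collect coef_cons coef_nil addr0 mulr1. Qed.

Lemma Gpow0 : Gpow 0 = 1.
Proof. by []. Qed.

Lemma GpowD p q : Gpow (p + q) = Gpow p * Gpow q.
Proof.
apply: numeral_ext => r; rewrite coef_Gpow /coef eval_mul.
by rewrite eval_collect eval_seq1 eval_collect eval_seq1 !mulr1.
Qed.

Lemma numeralE (x : numeral) :
  x = \sum_(t <- terms x) fin_num t.2 * Gpow t.1.
Proof.
apply: numeral_ext => p.
have coef_sum (s : seq (E * R)) :
    coef (val (\sum_(t <- s) fin_num t.2 * Gpow t.1)) p
    = \sum_(t <- s) coef (val (fin_num t.2 * Gpow t.1)) p.
  elim: s => [|t s IHs]; first by rewrite !big_nil coef_zero.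
  by rewrite !big_cons coef_add IHs.
rewrite coef_sum; apply: eq_bigr => t _; rewrite /coef eval_mul eval_collect.
by rewrite eval_seq1 /= eval_collect eval_seq1 /= add0r mulr1.
Qed.

Lemma Gpow_infinite (p : E) (c : R) : 0 < p -> fin_num c < Gpow p.
Proof.
move=> p0; suff -> : (fin_num c < Gpow p) = (0 < lead (Gpow p - fin_num c)).
  have e q : coef (val (Gpow p - fin_num c)) q = (p == q)%:R - (0 == q)%:R * c.
    by rewrite coef_add coef_opp coef_fin_num coef_Gpow.
  rewrite (@lead_at _ p) ?e ?eqxx ?(lt_eqF p0) ?mul0r ?subr0 ?oner_neq0 //.
  by move=> q pq; rewrite e !lt_eqF ?(lt_trans p0) // mul0r subr0.
by [].
Qed.
End Numeral.

(** * The ordered field of quotients of an ordered domain *)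

Notation "x %:F" := (FracField.tofrac x) : ring_scope.

Section OrderedFraction.
Variable D : realDomainType.
Implicit Types (n d : D) (x y : {fraction D}).

Lemma fracE x : x = (\n_(repr x)%qT)%:F / (\d_(repr x)%qT)%:F.
Proof.
rewrite -[LHS]reprK; case: (repr x) => -[n d] /= d0.
apply: (mulIf (_ : d%:F != 0)); rewrite ?tofrac_eq0 // divfK ?tofrac_eq0 //.
unlock FracField.tofrac; rewrite -[LHS]FracField.pi_mul /=.
apply/eqmodP; rewrite /= FracField.equivfE /FracField.mulf.
by rewrite !numden_Ratio ?mulr1 ?oner_neq0 //= mulrC.
Qed.

Lemma fracP x : exists n d, d != 0 /\ x = n%:F / d%:F.
Proof.
exists \n_(repr x)%qT, \d_(repr x)%qT.
by rewrite -fracE; split; first exact: denom_ratioP.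
Qed.

Definition frac_gt0 x : bool := 0 < \n_(repr x)%qT * \d_(repr x)%qT.

Lemma frac_gt0E n d : d != 0 -> frac_gt0 (n%:F / d%:F) = (0 < n * d).
Proof.
move=> d0; rewrite /frac_gt0; set x := _ / _.
have d'0 : \d_(repr x)%qT != 0 by exact: denom_ratioP.
have e : n * \d_(repr x)%qT = \n_(repr x)%qT * d.
  apply/eqP; rewrite -tofrac_eq !tofracM; apply/eqP.
  have xE := fracE x.
  move/eqP: xE; rewrite eqr_div ?tofrac_eq0 // => /eqP ->.
  by [].
rewrite -[LHS](@pmulr_lgt0 _ (d ^+ 2)) ?exprn_even_gt0 //.
rewrite -[RHS](@pmulr_lgt0 _ (\d_(repr x)%qT ^+ 2)) ?exprn_even_gt0 //.
congr (0 < _); transitivity (\n_(repr x)%qT * d * (\d_(repr x)%qT * d)).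
  by ring.
by rewrite -e; ring.
Qed.

Definition frac_lt x y : bool := frac_gt0 (y - x).
Definition frac_le x y : bool := (x == y) || frac_lt x y.
Definition frac_norm x : {fraction D} := if frac_lt x 0 then - x else x.

Fact frac_lt0_add x y : frac_lt 0 x -> frac_lt 0 y -> frac_lt 0 (x + y).
Proof.
rewrite /frac_lt !subr0.
have [n [d [d0 ->]]] := fracP x; have [m [e [e0 ->]]] := fracP y.
rewrite addf_div ?tofrac_eq0 // -!tofracM -tofracD !frac_gt0E ?mulf_neq0 //.
move=> nd me; have -> : (n * e + m * d) * (d * e)
    = (n * d) * e ^+ 2 + (m * e) * d ^+ 2.
  by ring.
by rewrite addr_gt0 // mulr_gt0 // exprn_even_gt0.
Qed.

Fact frac_lt0_mul x y : frac_lt 0 x -> frac_lt 0 y -> frac_lt 0 (x * y).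
Proof.
rewrite /frac_lt !subr0.
have [n [d [d0 ->]]] := fracP x; have [m [e [e0 ->]]] := fracP y.
rewrite mulf_div -!tofracM !frac_gt0E ?mulf_neq0 // mulrACA.
exact: mulr_gt0.
Qed.

Lemma frac_lt0N x : frac_lt x 0 = frac_lt 0 (- x).
Proof. by rewrite /frac_lt sub0r subr0. Qed.

Fact frac_lt0_ngt0 x : frac_lt 0 x -> ~~ frac_lt x 0.
Proof.
rewrite /frac_lt subr0 sub0r; have [n [d [d0 ->]]] := fracP x.
rewrite -mulNr -tofracN !frac_gt0E // mulNr oppr_gt0 -leNgt; exact: ltW.
Qed.

Fact frac_sub_gt0 x y : frac_lt 0 (y - x) = frac_lt x y.
Proof. by rewrite /frac_lt subr0. Qed.

Fact frac_lt0_total x : x != 0 -> frac_lt 0 x || frac_lt x 0.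
Proof.
rewrite /frac_lt subr0 sub0r; have [n [d [d0 ->]]] := fracP x.
rewrite mulf_eq0 invr_eq0 !tofrac_eq0 (negPf d0) orbF => n0.
by rewrite -mulNr -tofracN !frac_gt0E // mulNr oppr_gt0 orbC -neq_lt mulf_neq0.
Qed.

Fact frac_normN x : frac_norm (- x) = frac_norm x.
Proof.
have [->|x0] := eqVneq x 0; first by rewrite oppr0.
rewrite /frac_norm; have := frac_lt0_total x0; have := @frac_lt0_ngt0 x.
rewrite !frac_lt0N !opprK.
by case: (frac_lt 0 x) => [/(_ isT)/negPf -> _|_ /= ->]; rewrite ?opprK.
Qed.

Fact frac_ge0_norm x : frac_le 0 x -> frac_norm x = x.
Proof.
move=> /predU1P[<-|x0]; first by rewrite /frac_norm oppr0 if_same.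
by rewrite /frac_norm (negPf (frac_lt0_ngt0 x0)).
Qed.

Fact frac_le_def x y : frac_le x y = (x == y) || frac_lt x y.
Proof. by []. Qed.

HB.instance Definition _ := Num.IntegralDomain_isLtReal.Build {fraction D}
  frac_lt0_add frac_lt0_mul frac_lt0_ngt0 frac_sub_gt0 frac_lt0_total
  frac_normN frac_ge0_norm frac_le_def.

Lemma tofrac_lt n m : (n%:F < m%:F :> {fraction D}) = (n < m).
Proof.
rewrite -[LHS]/(frac_lt _ _) /frac_lt -tofracB -[_%:F]divr1 -tofrac1.
by rewrite frac_gt0E ?oner_neq0 // mulr1 subr_gt0.
Qed.

End OrderedFraction.

(** * The numbers

  Grosspowers are themselves numbers of the numeral system.  [gross R n]
  consists of the records whose grosspowers are nested at most [n] deep: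
  [gross R 0] is the finite numbers, the grosspowers in [gross R 1] are finite,
  those in [gross R n.+1] are any elements of [gross R n].  A quotient of two
  records need not be a record, so computations take place in [grossfield R n]. *)

Fixpoint gross (R : realFieldType) (n : nat) : realDomainType :=
  if n is m.+1 then numeral R (gross R m) else R.

Definition grossone (R : realFieldType) (n : nat) : gross R n.+1 :=
  @Gpow R (gross R n) 1.

Definition finite_gross (R : realFieldType) (n : nat) : R -> gross R n :=
  match n with
  | 0 => fun c => c
  | m.+1 => @fin_num R (gross R m)
  end.

Definition grossfield (R : realFieldType) (n : nat) : realFieldType :=
  {fraction gross R n}.

Definition finite_grossfield (R : realFieldType) (n : nat) (c : R) :
  grossfield R n := (finite_gross n c)%:F.

(** * The General Scheme *)

Variant lipschitz_rule :=
  | APriori | GlobalEstimate | MaximumTuning | MaximumAdditiveTuning.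

Variant characteristic_rule := Geometric | Information.

(* The domain is real, the values of the objective function lie in [F], which
   contains the reals through [emb]. *)
Section GeneralScheme.
Variables (R F : realFieldType) (emb : R -> F).
Variables (lr : lipschitz_rule) (cr : characteristic_rule).
Variables (Lbar : F) (r eps : R).
Variables (a b : R) (phi : R -> F).

(* [s] lists the executed trial points x^1, ..., x^k; [pt s 1], ..., [pt s k]
   are the reordered points x_1 < ... < x_k. *)
Section Iteration.
Variable s : seq R.

Definition ntrials : nat := size s.
Definition pt (i : nat) : R := nth 0 (sort <=%R s) i.-1.
Definition zv (i : nat) : F := phi (pt i).
Definition dx (i : nat) : F := emb (pt i - pt i.-1).

Definition slope (i : nat) : F := `|zv i - zv i.-1| / dx i.

(* All slopes and lengths are nonnegative, so 0 is neutral in the maxima. *)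
Definition max_slope : F := \big[Num.max/0]_(2 <= i < ntrials.+1) slope i.
Definition max_dx : F := \big[Num.max/0]_(2 <= i < ntrials.+1) dx i.
Definition local_slope (i : nat) : F :=
  \big[Num.max/0]_(j <- [:: i.-1; i; i.+1] | (2 <= j <= ntrials)%N) slope j.
Definition scaled_slope (i : nat) : F := max_slope * (dx i / max_dx).

Definition lip (i : nat) : F :=
  match lr with
  | APriori => Lbar
  | GlobalEstimate => if 0 < max_slope then emb r * max_slope else 1
  | MaximumTuning =>
      if 0 < max_slope
      then emb r * Num.max (local_slope i) (scaled_slope i) else 1
  | MaximumAdditiveTuning =>
      if 0 < max_slope
      then emb r * Num.max (slope i) ((local_slope i + scaled_slope i) / 2)
      else 1
  end.

Definition characteristic (i : nat) : F :=
  match cr with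
  | Geometric => (zv i + zv i.-1) / 2 - lip i * (dx i / 2)
  | Information =>
      2 * (zv i + zv i.-1) - lip i * dx i
      - (zv i - zv i.-1) ^+ 2 / (lip i * dx i)
  end.

Definition best : nat :=
  head 0 [seq i <- index_iota 2 ntrials.+1 |
            all (fun j => characteristic i <= characteristic j)
                (index_iota 2 ntrials.+1)].

Definition stop : bool := pt best - pt best.-1 <= eps.

Definition next_trial : F :=
  emb ((pt best + pt best.-1) / 2) - (zv best - zv best.-1) / (2 * lip best).

End Iteration.

(* [trials s]: the method executes [s] as its first trials, in this order.
   The prefixes executed determine the whole (finite or infinite) sequence of
   trials.  A trial needs a point of [a, b], where alone the objective function
   is defined, and an iteration needs pairwise distinct trial points, as
   x_1 < ... < x_k is required; for r <= 1 the scheme can violate either, and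
   the sequence of trials then ends there. *)
Inductive trials : seq R -> Prop :=
  | trials_start : trials [:: a; b]
  | trials_next s y of trials s & sorted <%R (sort <=%R s) & ~~ stop s
      & a <= y <= b & emb y = next_trial s : trials (rcons s y).

End GeneralScheme.

(* Main.v *)
(** Slopes are invariant under adding beta and are multiplied by alpha under
    scaling, and so is every estimate l_i built from them.  Hence each
    characteristic becomes alpha R_i + c beta with c independent of i, which
    keeps the minimizing interval, and alpha cancels in
    (z_t - z_(t-1)) / (2 l_t), which keeps the next trial.  This uses only that
    the finite numbers embed in the ordered field of values and that alpha > 0,
    not that alpha and beta are finite. *)

From HB Require Import structures.
Require Import Defs.
From mathcomp Require Import all_boot all_order all_algebra.
From mathcomp Require Import reals ring.
Import Order.TTheory GRing.Theory Num.Theory.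
Local Open Scope ring_scope.

(** * Order-preserving embeddings of ordered fields *)

Section MonotoneMorphism.
Variables (R F : realFieldType) (h : {rmorphism R -> F}).
Hypothesis h_le : {mono h : x y / x <= y}.

Lemma mono_lt x y : (h x < h y) = (x < y).
Proof. by rewrite !ltNge h_le. Qed.

Lemma mono_norm x : h `|x| = `|h x|.
Proof.
have [x0|x0] := lerP 0 x.
  by rewrite (ger0_norm x0) ger0_norm // -(rmorph0 h) h_le.
by rewrite (ltr0_norm x0) rmorphN ltr0_norm // -(rmorph0 h) mono_lt.
Qed.

Lemma mono_max x y : h (Num.max x y) = Num.max (h x) (h y).
Proof. by rewrite !maxEle h_le; case: ifP. Qed.

End MonotoneMorphism.

Arguments mono_lt {R F h} h_le x y.
Arguments mono_norm {R F h} h_le x.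
Arguments mono_max {R F h} h_le x y.

(** * Finite numbers as one-term records *)

Section FiniteNumbers.
Variables (R : realFieldType) (E : realDomainType).

Fact fin_num_zmod_morphism : zmod_morphism (@fin_num R E).
Proof.
move=> c d; apply: numeral_ext => p.
by rewrite coef_add coef_opp !coef_fin_num mulrBr.
Qed.

Fact fin_num_monoid_morphism : monoid_morphism (@fin_num R E).
Proof.
split=> // c d; apply: numeral_ext => p.
rewrite coef_fin_num /coef eval_mul eval_collect eval_seq1 eval_collect.
by rewrite eval_seq1 /= addr0 mulrAC mulrA.
Qed.

(** The sign of a numeral is read off its leading grossdigit, so this reduces comparing finite
    records to comparing in [R]. *)
Lemma lead_fin_num c : lead (@fin_num R E c) = c.
Proof.
have [->|c0] := eqVneq c 0.
  by have := fin_num_zmod_morphism 0 0; rewrite !subrr => ->; apply: lead0.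
rewrite (@lead_at _ _ _ 0) ?coef_fin_num ?eqxx ?mul1r // => q q0.
by rewrite coef_fin_num lt_eqF ?mul0r.
Qed.

Lemma fin_num_lt c d : (@fin_num R E c < fin_num _ d) = (c < d).
Proof.
rewrite -[LHS]/(0 < lead (fin_num E d - fin_num E c)).
by rewrite -fin_num_zmod_morphism lead_fin_num subr_gt0.
Qed.

End FiniteNumbers.

(** * Finite numbers inside the field of quotients *)

Section FiniteGross.
Variables (R : realFieldType) (n : nat).

Fact finite_grossfield_zmod_morphism : zmod_morphism (@finite_grossfield R n).
Proof.
move=> c d; rewrite /finite_grossfield -tofracB; congr (_ %:F).
(* At depth 0 [finite_gross] is the identity. *)
by case: n => [|m] //; apply: fin_num_zmod_morphism.
Qed.

Fact finite_grossfield_monoid_morphism :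
  monoid_morphism (@finite_grossfield R n).
Proof.
rewrite /finite_grossfield; case: n => [|m]; first exact: tofrac_is_monoid_morphism.
have [f1 fM] := fin_num_monoid_morphism R (gross R m).
by split=> [|c d]; rewrite /= ?f1 ?tofrac1 // fM tofracM.
Qed.

HB.instance Definition _ := GRing.isZmodMorphism.Build _ _ _
  finite_grossfield_zmod_morphism.
HB.instance Definition _ := GRing.isMonoidMorphism.Build _ _ _
  finite_grossfield_monoid_morphism.

Lemma finite_grossfield_le : {mono @finite_grossfield R n : x y / x <= y}.
Proof.
move=> x y; rewrite !leNgt; congr (~~ _); rewrite tofrac_lt.
by case: n => [|m] //; apply: fin_num_lt.
Qed.

End FiniteGross.

(** * Invariance of the scheme under an affine change of the values *)

Section Homogeneity.
Variables (R F : realFieldType) (emb : {rmorphism R -> F}).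
Hypothesis emb_le : {mono emb : x y / x <= y}.
Variables (lr : lipschitz_rule) (cr : characteristic_rule).
Variables (Lbar r eps a b : R) (f : R -> R) (A B : F) (g : R -> F).
Hypothesis A0 : 0 < A.
Hypothesis gE : forall x, g x = A * emb (f x) + B.

(** Positivity of [A] lets the scaling pass through the maxima from which the estimates are
    built. *)
Let maxA x y : A * emb (Num.max x y) = Num.max (A * emb x) (A * emb y).
Proof. by rewrite mono_max // maxr_pMr // ltW. Qed.

Let bigmaxA I (s : seq I) (P : pred I) (u : I -> R) :
  \big[Num.max/0]_(i <- s | P i) (A * emb (u i)) =
  A * emb (\big[Num.max/0]_(i <- s | P i) u i).
Proof.
by apply/esym/(big_morph _ maxA); rewrite rmorph0 mulr0.
Qed.

Section Iteration.
Variable s : seq R.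
Implicit Types i j : nat.

Lemma zv_affine i : zv g s i = A * emb (zv f s i) + B.
Proof. exact: gE. Qed.

Lemma zvB_affine i j : zv g s i - zv g s j = A * emb (zv f s i - zv f s j).
Proof. by rewrite !zv_affine; ring. Qed.

(** [B] cancels in the difference of values, and [A > 0] leaves the absolute value unchanged in
    sign. *)
Lemma slope_affine i : slope emb g s i = A * emb (slope id f s i).
Proof.
rewrite /slope zvB_affine normrM (gtr0_norm A0) -(mono_norm emb_le).
by rewrite -mulrA -fmorph_div.
Qed.

Lemma max_slope_affine : max_slope emb g s = A * emb (max_slope id f s).
Proof. by rewrite -bigmaxA; apply: eq_bigr => i _; apply: slope_affine. Qed.

Lemma max_slope_affine_gt0 : (0 < max_slope emb g s) = (0 < max_slope id f s).
Proof. by rewrite max_slope_affine pmulr_rgt0 // -(rmorph0 emb) mono_lt. Qed.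

Lemma local_slope_affine i :
  local_slope emb g s i = A * emb (local_slope id f s i).
Proof. by rewrite -bigmaxA; apply: eq_bigr => j _; apply: slope_affine. Qed.

Lemma max_dx_emb : max_dx emb s = emb (max_dx id s).
Proof. by rewrite /max_dx (big_morph emb (mono_max emb_le) (rmorph0 emb)). Qed.

(** Only the factor [max_slope] carries [A]; the ratio of lengths depends on the trial points
    alone. *)
Lemma scaled_slope_affine i :
  scaled_slope emb g s i = A * emb (scaled_slope id f s i).
Proof.
by rewrite /scaled_slope max_slope_affine max_dx_emb -mulrA rmorphM fmorph_div.
Qed.

(* The default estimate 1 does not scale; it is harmless because the trial
   values are then all equal. *)
Lemma lip_affine_or_default :
  (forall i, lip emb lr (A * emb Lbar) r g s i = A * emb (lip id lr Lbar r f s i))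
  \/ [/\ max_slope id f s <= 0, forall i, lip emb lr (A * emb Lbar) r g s i = 1
       & forall i, lip id lr Lbar r f s i = 1].
Proof.
rewrite /lip max_slope_affine_gt0; case: lr; first by left.
- case: ltP => m0; [left=> i | by right].
  by rewrite max_slope_affine; ring.
- case: ltP => m0; [left=> i | by right].
  by rewrite local_slope_affine scaled_slope_affine -maxA; ring.
- case: ltP => m0; [left=> i | by right].
  rewrite slope_affine local_slope_affine scaled_slope_affine.
  rewrite rmorphM mulrCA maxA; congr (_ * Num.max _ _).
  by field.
Qed.

(** Both rules have degree one in the values and the estimate jointly. A shift by [B] moves the mean
    of two values by [B] and twice their sum by [4 * B], whatever the interval. *)
Lemma characteristic_affine i :
  lip emb lr (A * emb Lbar) r g s i = A * emb (lip id lr Lbar r f s i) ->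
  characteristic emb lr cr (A * emb Lbar) r g s i =
  A * emb (characteristic id lr cr Lbar r f s i)
  + (if cr is Geometric then 1 else 4) * B.
Proof.
move=> lipA; rewrite /characteristic lipA /dx; move: (lip _ _ _ _ _ _ _) => l.
have quotA u v : (A * u) ^+ 2 / (A * v) = A * (u ^+ 2 / v).
  (* Abstracting [v^-1] covers [v = 0] as well, so only [A != 0] is left to check. *)
  by rewrite invfM; move: v^-1 => w; field; rewrite gt_eqF.
case: cr; first by rewrite !zv_affine; field.
rewrite zvB_affine -[A * _ * _]mulrA quotA !zv_affine.
by rewrite -rmorphXn -rmorphM -fmorph_div; ring.
Qed.

(* [pt s 0 = pt s 1], as predecessors are truncated. *)
Lemma zv_const i : max_slope id f s <= 0 -> (i <= ntrials s)%N ->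
  zv f s i = zv f s 0.
Proof.
move=> m0; elim: i => [//|[//|i] IHi] ik; rewrite -IHi ?(ltnW ik) //.
have : slope id f s i.+2 <= 0.
  by apply: le_trans m0; apply: le_bigmax_seq; rewrite ?mem_index_iota.
have : 0 <= pt s i.+2 - pt s i.+1.
  rewrite subr_ge0; apply: (sorted_leq_nth le_trans lexx) => //.
  - exact: sort_le_sorted.
  - by rewrite inE size_sort ltnW.
  - by rewrite inE size_sort.
rewrite /slope /dx /= le_eqVlt => /predU1P[d0 _|d0].
  (* For coinciding points the slope is 0 by the convention on division; the values agree because
     the points do. *)
  by congr f; apply/eqP; rewrite -subr_eq0 -d0.
by rewrite pmulr_lle0 ?invr_gt0 // normr_le0 subr_eq0 => /eqP.
Qed.

Lemma characteristic_le_affine i j :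
  (1 < i <= ntrials s)%N -> (1 < j <= ntrials s)%N ->
  (characteristic emb lr cr (A * emb Lbar) r g s i
     <= characteristic emb lr cr (A * emb Lbar) r g s j)
  = (characteristic id lr cr Lbar r f s i
     <= characteristic id lr cr Lbar r f s j).
Proof.
move=> ik jk; have [lipA|[m0 l1 l1']] := lip_affine_or_default.
  by rewrite !characteristic_affine // lerD2r ler_pM2l // emb_le.
(* With default estimates all values coincide, so both sides only compare interval lengths. *)
rewrite /characteristic !zv_affine !l1 !l1'.
have [[_ ik'] [_ jk']] := (andP ik, andP jk).
rewrite !(@zv_const i, @zv_const j, @zv_const i.-1, @zv_const j.-1) //;
  rewrite ?(leq_trans (leq_pred _)) //.
rewrite !subrr !expr0n /= !mul0r !subr0 !mul1r /dx.
case: cr; rewrite !lerD2l !lerN2; last by rewrite emb_le.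
by rewrite !ler_pM2r ?invr_gt0 // emb_le.
Qed.

Lemma best_affine :
  best emb lr cr (A * emb Lbar) r g s = best id lr cr Lbar r f s.
Proof.
rewrite /best; congr head; apply: eq_in_filter => i.
rewrite mem_index_iota => ik; apply: eq_in_all => j.
rewrite mem_index_iota => jk; exact: characteristic_le_affine.
Qed.

(** Brings the selected index within the range of [zv_const]. *)
Lemma best_le_ntrials : (best id lr cr Lbar r f s <= ntrials s)%N.
Proof.
rewrite /best; set u := [seq _ <- _ | _].
have : {subset u <= index_iota 2 (ntrials s).+1}.
  by apply/mem_subseq/filter_subseq.
(* An empty selection yields the default index 0, which is in range. *)
case: u => [//|i u] /(_ i (mem_head _ _)).
by rewrite mem_index_iota => /andP[].
Qed.

Lemma next_trial_affine :
  next_trial emb lr cr (A * emb Lbar) r g s =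
  emb (next_trial id lr cr Lbar r f s).
Proof.
rewrite /next_trial best_affine; set t := best _ _ _ _ _ _ _.
rewrite rmorphB; congr (_ - _); rewrite zvB_affine fmorph_div rmorphM rmorph_nat.
have [->|[m0 _ _]] := lip_affine_or_default.
  by rewrite mulrCA -mulf_div divff ?mul1r // gt_eqF.
(* Under the default estimate [A] does not cancel, but the difference it multiplies vanishes. *)
suff -> : zv f s t - zv f s t.-1 = 0 by rewrite rmorph0 mulr0 !mul0r.
have tk : (t <= ntrials s)%N := best_le_ntrials.
by rewrite !zv_const ?subrr // (leq_trans (leq_pred t)).
Qed.

End Iteration.

Lemma trials_affine s :
  trials emb lr cr (A * emb Lbar) r eps a b g s
  <-> trials id lr cr Lbar r eps a b f s.
Proof.
have stopE u : stop emb lr cr (A * emb Lbar) r eps g u =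
    stop id lr cr Lbar r eps f u by rewrite /stop best_affine.
split; elim=> [|u y _ IHu us uN yab yn]; try exact: trials_start.
  apply: trials_next => //; first by rewrite -stopE.
  (* The trial for [g] is computed in [F]; injectivity of [emb] brings the equation back to [R]. *)
  by apply: (fmorph_inj emb); rewrite yn next_trial_affine.
apply: trials_next => //; first by rewrite stopE.
by rewrite next_trial_affine -yn.
Qed.

End Homogeneity.

Theorem theorem1 (R : realType) (a b L Lbar r eps : R) (f : R -> R)
    (n : nat) (alpha beta : gross R n)
    (lr : lipschitz_rule) (cr : characteristic_rule) :
  a < b ->
  0 < L ->
  {in `[a, b] &, forall x y, `|f x - f y| <= L * `|x - y|} ->
  L < Lbar ->
  0 < r ->
  0 < eps ->
  0 < alpha ->
  let g (x : R) : grossfield R n := (alpha * finite_gross n (f x) + beta)%:F in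
  forall s : seq R,
    trials (@finite_grossfield R n) lr cr
      (alpha%:F * finite_grossfield n Lbar) r eps a b g s
    <-> trials id lr cr Lbar r eps a b f s.
Proof.
move=> _ _ _ _ _ _ alpha_gt0 g s.
(* The field of quotients serves as [F], with the images of [alpha] and [beta] as [A] and [B]. *)
apply: (@trials_affine _ _ (@finite_grossfield R n) _ _ _ _ _ _ _ _ _ _ beta%:F).
- exact: finite_grossfield_le.
- by rewrite -tofrac0 tofrac_lt.
by move=> x; rewrite /g tofracD tofracM.
Qed.
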